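(* Let $\mathcal{S}$ be a complete idempotent semiring equipped with a dual product $\odot$, and let $A\in\mathcal{S}^{n\times p}$. The mapping $\Lambda_A:\mathcal{S}^{p\times m}\to\mathcal{S}^{n\times m}$, $X\mapsto A\odot X$, is dually residuated. Its dual residual, denoted $\Lambda_A^\flat:\mathcal{S}^{n\times m}\to\mathcal{S}^{p\times m}$, $X\mapsto A\backslash_{\odot}X$, is given by $$(A\backslash_{\odot}X)_{ij}=\bigoplus_{k=1}^{n}a_{ki}\backslash_{\odot}x_{kj},$$ where for scalars $a,x\in\mathcal S$, $a\backslash_{\odot}x$ denotes the smallest $y\in\mathcal{S}$ with $a\odot y\succeq x$, with the following rules: $\top\backslash_{\odot}x=\varepsilon$ for all $x$, $\varepsilon\backslash_{\odot}x=\top$ for all $x\neq\varepsilon$, and $\varepsilon\backslash_{\odot}\varepsilon=\varepsilon$.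
   Context: An idempotent semiring is a set $\mathcal{S}$ with operations $\oplus,\otimes$ such that $(\mathcal{S},\oplus,\varepsilon)$ is a commutative monoid with $a\oplus a=a$ for all $a$, $(\mathcal{S},\otimes,e)$ is a monoid, $\otimes$ distributes over $\oplus$, and $\varepsilon$ is absorbing for $\otimes$. It is ordered by $a\succeq b\iff a=a\oplus b$. It is complete if arbitrary sums $\bigoplus$ exist and $\otimes$ distributes over arbitrary sums; then it is a complete lattice with join $\bigoplus$, meet $\bigwedge$, bottom $\varepsilon$ and top $\top$. A dual product on $\mathcal{S}$ is an operation $\odot$ such that $(\mathcal{S},\odot,e)$ is a monoid (with the same neutral element $e$ as $\otimes$), $\odot$ distributes with respect to $\bigwedge$ of infinitely many elements, and $\top$ is absorbing: $\top\odot a=a\odot\top=\top$ for all $a$. For $A\in\mathcal{S}^{n\times p}$ and $X\in\mathcal{S}^{p\times m}$, the dual matrix product is $(A\odot X)_{ij}=\bigwedge_{k=1}^{p} (a_{ik}\odot x_{kj})$. Matrices are ordered entrywise. An order-preserving mapping $g:\mathcal{D}\to\mathcal{E}$ between ordered sets is dually residuated if for every $y\in\mathcal{E}$ the set $\{x\in\mathcal{D}:g(x)\succeq y\}$ has a greatest lower bound that belongs to the set; it is denoted $g^\flat(y)$, and $g^\flat$ is called the dual residual of $g$.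
   Formalization: The rule ε\x = ⊤ for x ≠ ε fails for some dual products (it can happen that ε⊙b = b with ε < b < ⊤), so it is proved only under the assumption, equivalent to the rule, that ε⊙y = ε for all y ≠ ⊤; every other claim is proved without it. *)

(* Defs.v *)
From HB Require Import structures.
From mathcomp Require Import all_boot all_order all_algebra.
From mathcomp Require Import boolp classical_sets.

Set Implicit Arguments.
Unset Strict Implicit.
Unset Printing Implicit Defensive.

Import Order.TTheory GRing.Theory.

Local Open Scope classical_set_scope.
Local Open Scope ring_scope.
Local Open Scope order_scope.

(* The operations (+), (x), epsilon, e are the semiring operations +, *, 0, 1.
   [pzSemiRingType] is noncommutative and includes the absorption law for 0;
   it does not require 1 != 0. *)
Definition sum_le (S : pzSemiRingType) (b a : S) : bool := a == (a + b)%R.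

(* [bigsum E] is the sum of an arbitrary family, given by the set E of its
   terms; [bigsum_ub] and [bigsum_le] say that it is the join of E. *)
HB.mixin Record isCompleteIdempotent S of GRing.PzSemiRing S := {
  addii : forall a : S, (a + a)%R = a;
  bigsum : set S -> S;
  bigsum_ub : forall (E : set S) (x : S), E x -> sum_le x (bigsum E);
  bigsum_le : forall (E : set S) (u : S),
    (forall x, E x -> sum_le x u) -> sum_le (bigsum E) u;
  mul_bigsumr : forall (a : S) (E : set S),
    (a * bigsum E)%R = bigsum [set (a * x)%R | x in E];
  mul_bigsuml : forall (a : S) (E : set S),
    (bigsum E * a)%R = bigsum [set (x * a)%R | x in E]
}.

#[short(type="completeIdemSemiRingType")]
HB.structure Definition CompleteIdemSemiRing :=
  {S of GRing.PzSemiRing S & isCompleteIdempotent S}.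

Section SumOrder.
Variable S : completeIdemSemiRingType.

Lemma sum_le_refl : reflexive (@sum_le S).
Proof. by move=> a; rewrite /sum_le addii. Qed.

Lemma sum_le_anti : antisymmetric (@sum_le S).
Proof. by move=> a b /andP[/eqP ab /eqP ba]; rewrite ba addrC -ab. Qed.

Lemma sum_le_trans : transitive (@sum_le S).
Proof.
move=> b a c /eqP ab /eqP bc; rewrite /sum_le {2}bc -addrA -ab -bc; exact/eqP.
Qed.

End SumOrder.

Fact sum_display : Order.disp_t. Proof. exact: Order.Disp tt tt. Qed.

HB.instance Definition _ (S : completeIdemSemiRingType) :=
  Order.Le_isPOrder.Build sum_display (CompleteIdemSemiRing.sort S)
    (@sum_le_refl S) (@sum_le_anti S) (@sum_le_trans S).

Definition cis_top (S : completeIdemSemiRingType) : S :=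
  bigsum [set: S].

Definition bigmeet (S : completeIdemSemiRingType)
    (E : set S) : S := bigsum (lbound E).

Arguments cis_top : clear implicits.

(* In [dprod_meetr] and [dprod_meetl] the set may be empty, as its meet is then
   the top element and the equation reduces to the absorption laws. *)
Record dualProduct (S : completeIdemSemiRingType) :=
  DualProduct {
    dprod :> S -> S -> S;
    dprodA : associative dprod;
    dprod1l : left_id 1%R dprod;
    dprod1r : right_id 1%R dprod;
    dprod_meetr : forall (a : S) (E : set S),
      dprod a (bigmeet E) = bigmeet [set dprod a x | x in E];
    dprod_meetl : forall (a : S) (E : set S),
      dprod (bigmeet E) a = bigmeet [set dprod x a | x in E];
    dprod_topl : left_zero (cis_top S) dprod;
    dprod_topr : right_zero (cis_top S) dprod
  }.

Section MatrixOrder.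
Variables (d : Order.disp_t) (T : porderType d) (m n : nat).

Definition le_matrix (A B : 'M[T]_(m, n)) : bool :=
  [forall i, forall j, A i j <= B i j].

Lemma le_matrixP (A B : 'M[T]_(m, n)) :
  reflect (forall i j, A i j <= B i j) (le_matrix A B).
Proof.
apply: (iffP idP) => [/forallP le_AB i j|le_AB].
  exact: (forallP (le_AB i)).
by apply/forallP => i; apply/forallP.
Qed.

Lemma le_matrix_refl : reflexive le_matrix.
Proof. by move=> A; apply/le_matrixP. Qed.

Lemma le_matrix_anti : antisymmetric le_matrix.
Proof.
move=> A B /andP[/le_matrixP le_AB /le_matrixP le_BA].
by apply/matrixP => i j; apply/le_anti; rewrite le_AB le_BA.
Qed.

Lemma le_matrix_trans : transitive le_matrix.
Proof.
move=> B A C /le_matrixP le_AB /le_matrixP le_BC.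
by apply/le_matrixP => i j; apply: le_trans (le_AB i j) (le_BC i j).
Qed.

HB.instance Definition _ := Order.Le_isPOrder.Build d 'M[T]_(m, n)
  le_matrix_refl le_matrix_anti le_matrix_trans.

End MatrixOrder.

Definition mxdprod (S : completeIdemSemiRingType)
    (odot : dualProduct S) (n p m : nat)
    (A : 'M[S]_(n, p)) (X : 'M[S]_(p, m)) : 'M[S]_(n, m) :=
  \matrix_(i, j) bigmeet [set odot (A i k) (X k j) | k in [set: 'I_p]].

Section DualResiduation.
Variables (d d' : Order.disp_t) (D : porderType d) (E : porderType d').

Definition dual_residual_at (g : D -> E) (y : E) (x : D) : Prop :=
  infimums [set z | y <= g z] x /\ y <= g x.

Definition dually_residuated (g : D -> E) : Prop :=
  {homo g : x y / x <= y} /\ forall y, exists x, dual_residual_at g y x.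

Definition is_dual_residual (g : D -> E) (h : E -> D) : Prop :=
  forall y, dual_residual_at g y (h y).

End DualResiduation.

(* The meet of all y with a (.) y >= x; it is the smallest such y only when it is
   itself one of them.  No special value is imposed at a = 0.  In particular
   "dldiv 0 x = top for x != 0" needs 0 (.) y = 0 for all y != top, which fails
   e.g. in the chain 0 < 1 < b < t with a * c = max a c for a, c != 0 and
   b (.) 0 = 0 (.) b = b (.) b = b, 0 (.) 0 = 0: there dldiv 0 b = b. *)
Definition dldiv (S : completeIdemSemiRingType)
    (odot : dualProduct S) (a x : S) : S :=
  bigmeet [set y | x <= odot a y].

(* Main.v *)
(** Since [odot a] preserves arbitrary meets, the set of [y] with
    [x <= odot a y] contains its own meet [dldiv odot a x]; hence
    [x <= odot a y] iff [dldiv odot a x <= y].  Entrywise, [X <= A (.) Y] says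
    [X k j <= odot (A k i) (Y i j)] for all [k], [i], [j], i.e.
    [dldiv odot (A k i) (X k j) <= Y i j], and the least such [Y] is obtained by
    joining over [k]. *)
Require Import Defs.
From HB Require Import structures.
From mathcomp Require Import all_boot all_order all_algebra.
From mathcomp Require Import boolp classical_sets.

Set Implicit Arguments.
Unset Strict Implicit.
Unset Printing Implicit Defensive.

Local Open Scope ring_scope.

Import Order.TTheory GRing.Theory.
Local Open Scope classical_set_scope.

Section CompleteOrder.
Variable S : completeIdemSemiRingType.
Implicit Types (x y z u : S) (E : set S).

Lemma le_sumE x y : (x <= y)%O = (y == y + x).
Proof. by []. Qed.

Lemma le0s x : ((0 : S) <= x)%O.
Proof. by rewrite le_sumE addr0. Qed.

Lemma les_top x : (x <= cis_top S)%O.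
Proof. exact: bigsum_ub. Qed.

(** Each element of [E] bounds [lbound E] from above, hence lies above the join of [lbound E], which
    encodes the meet. *)
Lemma bigmeet_lb E x : E x -> (bigmeet E <= x)%O.
Proof. by move=> Ex; apply: bigsum_le => y; apply. Qed.

Lemma bigmeet_ge E u : (forall x, E x -> (u <= x)%O) -> (u <= bigmeet E)%O.
Proof. by move=> uE; apply: bigsum_ub. Qed.

Lemma le_bigmeetP E u :
  (u <= bigmeet E)%O <-> (forall x, E x -> (u <= x)%O).
Proof.
split=> [uE x Ex|]; last exact: bigmeet_ge.
exact: le_trans uE (bigmeet_lb Ex).
Qed.

Lemma ge_adds x y u : ((x + y : S) <= u)%O = (x <= u)%O && (y <= u)%O.
Proof.
apply/idP/andP => [xyu|[]].
  by split; apply: le_trans xyu; rewrite le_sumE;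
    [rewrite addrAC addii | rewrite -addrA addii].
by rewrite !le_sumE => /eqP xu /eqP yu; rewrite addrA -xu -yu.
Qed.

(** Finite sums are joins by idempotence; the empty sum [0] is the bottom element, so [n = 0] is
    covered. *)
Lemma ge_sumsP (n : nat) (f : 'I_n -> S) u :
  ((\sum_(k < n) f k : S) <= u)%O <-> forall k, (f k <= u)%O.
Proof.
split=> [fu k|fu]; last first.
  apply: (big_ind (fun z => (z <= u)%O)) => // [|x y xu yu]; first exact: le0s.
  by rewrite ge_adds xu.
by move: fu; rewrite (bigD1 k) //= ge_adds => /andP[].
Qed.

End CompleteOrder.

Section DualProduct.
Variables (S : completeIdemSemiRingType) (odot : dualProduct S).
Implicit Types a x y : S.

Lemma dldiv_le a x y : (x <= odot a y)%O -> (dldiv odot a x <= y)%O.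
Proof. exact: bigmeet_lb. Qed.

Lemma le_dprod_dldiv a x : (x <= odot a (dldiv odot a x))%O.
Proof. by rewrite dprod_meetr; apply/bigmeet_ge => _ [y xy <-]. Qed.

(** Meet preservation gives monotonicity: [x <= y] makes [x] the meet of the pair [x], [y], so
    [odot a x] is a meet with [odot a y] among its terms. *)
Lemma le_dprodr a x y : (x <= y)%O -> (odot a x <= odot a y)%O.
Proof.
move=> xy; have -> : x = bigmeet [set x; y].
  apply/le_anti/andP; split; last by apply: bigmeet_lb; left.
  by apply: bigmeet_ge => _ [->|->].
by rewrite dprod_meetr; apply: bigmeet_lb; exists y => //; right.
Qed.

Lemma dldiv_adj a x y : (dldiv odot a x <= y)%O <-> (x <= odot a y)%O.
Proof.
split=> [xy|]; last exact: dldiv_le.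
exact: le_trans (le_dprod_dldiv a x) (le_dprodr a xy).
Qed.

(** Since the top absorbs on the left, even the bottom [y = 0] satisfies
    [x <= odot (cis_top S) y]. *)
Lemma dldiv_top x : dldiv odot (cis_top S) x = 0.
Proof.
apply/le_anti; rewrite le0s andbT.
by apply: dldiv_le; rewrite dprod_topl les_top.
Qed.

Lemma dldivx0 a : dldiv odot a 0 = 0.
Proof. by apply/le_anti; rewrite le0s andbT; apply: dldiv_le; exact: le0s. Qed.

Lemma dldiv0x x : (forall y, y <> cis_top S -> odot 0 y = 0) ->
  x <> 0 -> dldiv odot 0 x = cis_top S.
Proof.
move=> odot0 x0; apply/le_anti; rewrite les_top /=.
(* Only the top can satisfy [x <= odot 0 y]: any other [y] would give [x <= 0], against [x <> 0]. *)
apply: bigmeet_ge => y /= xy.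
have [-> //|/eqP /odot0 y0] := eqVneq y (cis_top S).
by case: x0; apply/le_anti; rewrite le0s andbT -y0.
Qed.

Section Matrix.
Variables (n p m : nat) (A : 'M[S]_(n, p)).

Definition mxdldiv (X : 'M[S]_(n, m)) : 'M[S]_(p, m) :=
  \matrix_(i < p, j < m) \sum_(k < n) dldiv odot (A k i) (X k j).

Lemma mxdldiv_adj (X : 'M[S]_(n, m)) (Y : 'M[S]_(p, m)) :
  (mxdldiv X <= Y)%O <-> (X <= mxdprod odot A Y)%O.
Proof.
split=> [/le_matrixP XY|/le_matrixP XY]; apply/le_matrixP => i j; rewrite mxE.
  apply: bigmeet_ge => _ [k _ <-]; apply/dldiv_adj.
  by move: (XY k j); rewrite mxE => /ge_sumsP.
apply/ge_sumsP => k; apply: dldiv_le.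
(* Among the terms of the meet in entry [(k, j)], the one of index [i] is the bound needed for
   [Y i j]. *)
by move: (XY k j); rewrite mxE => /le_bigmeetP; apply; exists i.
Qed.

Lemma mxdldiv_dual_residual :
  is_dual_residual (fun Y : 'M[S]_(p, m) => mxdprod odot A Y) mxdldiv.
Proof.
move=> X; have geX : (X <= mxdprod odot A (mxdldiv X))%O.
  exact/mxdldiv_adj.
(* By [geX] the set contains [mxdldiv X], so every lower bound of the set lies below it. *)
by split=> //; split=> [Y /mxdldiv_adj //|Y]; apply.
Qed.

(** The adjunction alone gives monotonicity: [mxdldiv (mxdprod odot A X) <= X <= Y], then transpose
    back. *)
Lemma le_mxdprodr :
  {homo (fun Y : 'M[S]_(p, m) => mxdprod odot A Y) : X Y / (X <= Y)%O}.
Proof. by move=> X Y XY; apply/mxdldiv_adj/(le_trans _ XY)/mxdldiv_adj. Qed.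

End Matrix.
End DualProduct.

Theorem corollary30 (S : completeIdemSemiRingType)
    (odot : dualProduct S) (n p m : nat) (A : 'M[S]_(n, p)) :
  let Lambda : 'M[S]_(p, m) -> 'M[S]_(n, m) := fun X => mxdprod odot A X in
  [/\ dually_residuated Lambda,
      is_dual_residual Lambda
        (fun X => \matrix_(i < p, j < m)
                    \sum_(k < n) dldiv odot (A k i) (X k j)),
      (forall a x : S, (x <= odot a (dldiv odot a x))%O /\
         (forall y : S, (x <= odot a y)%O -> (dldiv odot a x <= y)%O))
    & [/\ (forall x : S, dldiv odot (cis_top S) x = 0),
          ((forall y : S, y <> cis_top S -> odot 0 y = 0) ->
             forall x : S, x <> 0 -> dldiv odot 0 x = cis_top S)
        & dldiv odot 0 0 = 0]].
Proof.
move=> Lambda; have res := @mxdldiv_dual_residual S odot n p m A.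
split=> //.
- by split=> [|X]; [exact: le_mxdprodr | exists (mxdldiv odot A X); exact: res].
- by move=> a x; split=> [|y]; [exact: le_dprod_dldiv|exact: dldiv_le].
- by split=> [x|? x|]; [exact: dldiv_top|exact: dldiv0x|exact: dldivx0].
Qed.
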